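(* Let $(x,y)\in\mathbb{R}^2$ with $x>0$ and $x+y>0$, and define sequences $\{x_n\}$, $\{y_n\}$ by $(x_0,y_0)=(x,y)$ and $(x_{n+1},y_{n+1})=(\mu_1(x_n,y_n),\mu_2(x_n,y_n))$ for $n\ge0$. Then there exists an integer $N\ge0$ such that $0<y_n\le x_n$ for every $n\ge N$, and such that $$\lim_{n\to\infty}x_n=\lim_{n\to\infty}y_n=\frac{x_N}{F\Big(\frac14,\frac14,1;1-\dfrac{y_N^2}{x_N^2}\Big)}.$$
   Context: On $\mathbb{S}_{(-1,\infty)}=\{(x,y)\in\mathbb{R}^2\mid x>0,\ x+y>0\}$ put $\mu_0(x,y)=\sqrt{x\cdot\frac{x+y}{2}}$ (positive square root), $\mu_1(x,y)=m_A(x,\mu_0(x,y))$ and $\mu_2(x,y)=\nu(x,\mu_0(x,y))$, where $m_A(x,y)=\frac{x+y}{2}$, $m_H(x,y)=\frac{2xy}{x+y}$ and $\nu(x,y)=2m_H(x,y)-m_A(x,y)$. Explicitly $\mu_1(x,y)=\frac{2x+\sqrt{2x(x+y)}}{4}$ and $\mu_2(x,y)=\frac{6\sqrt{2x(x+y)}-y-3x}{2(2x+\sqrt{2x(x+y)})}\cdot x$. The map $(\mu_1,\mu_2)$ sends $\mathbb{S}_{(-1,\infty)}$ into itself, so the sequences are well defined. $F(a,b,c;z)=\sum_{n=0}^\infty\frac{(a,n)(b,n)}{(c,n)(1,n)}z^n$ for $|z|<1$ is the hypergeometric series, $(a,n)=a(a+1)\cdots(a+n-1)$. *)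

(* Defs.v *)
From Stdlib Require Import Reals.
From Coquelicot Require Import Coquelicot.
Open Scope R_scope.

Definition m_A (x y : R) : R := (x + y) / 2.

Definition m_H (x y : R) : R := 2 * x * y / (x + y).

Definition nu (x y : R) : R := 2 * m_H x y - m_A x y.

Definition mu0 (x y : R) : R := sqrt (x * ((x + y) / 2)).

Definition mu1 (x y : R) : R := m_A x (mu0 x y).

Definition mu2 (x y : R) : R := nu x (mu0 x y).

Fixpoint mu_iter (x y : R) (n : nat) : R * R :=
  match n with
  | O => (x, y)
  | S m => let p := mu_iter x y m in (mu1 (fst p) (snd p), mu2 (fst p) (snd p))
  end.

Definition x_seq (x y : R) (n : nat) : R := fst (mu_iter x y n).

Definition y_seq (x y : R) (n : nat) : R := snd (mu_iter x y n).

(* The shifted factorial (a,n) = a (a+1) ... (a+n-1), with (a,0) = 1. *)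
Fixpoint shifted_fact (a : R) (n : nat) : R :=
  match n with
  | O => 1
  | S m => shifted_fact a m * (a + INR m)
  end.

(* [PSeries] is total; the value is the sum of the hypergeometric series
   when the series converges, in particular for |z| < 1 and c not in
   {0, -1, -2, ...}. *)
Definition hypergeom (a b c z : R) : R :=
  PSeries
    (fun n => (shifted_fact a n * shifted_fact b n)
              / (shifted_fact c n * shifted_fact 1 n)) z.

(* Main.v *)
Require Import Defs.
From Stdlib Require Import Reals.
From Coquelicot Require Import Coquelicot.
From Stdlib Require Import Lra Lia Psatz.
Open Scope R_scope.

(** With t = y / x and s = sqrt ((1 + t) / 2), one step of the iteration
    multiplies x by (1 + s) / 2 and turns t into tau s = 8 s / (1 + s)^2 - 1,
    so that the new s is 2 sqrt s / (1 + s).  In other words, x and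
    m = mu0 x y = s x follow the arithmetic-geometric mean iteration, and the
    theorem is Gauss's evaluation of that mean, in the form it takes after the
    quadratic transformation
    F(1/2,1/2,1; (1 - t)/2) = F(1/4,1/4,1; 1 - t^2) for 0 < t.

    Put G t = F(1/4,1/4,1; 1 - t^2) on 0 < t <= 1.  The heart of the proof is
    Landen's transformation (lemma [landen]),

      G (tau s) = (1 + s) / 2 * G (2 s^2 - 1),

    where 2 s^2 - 1 = t is the ratio before the step and tau s the ratio after
    it.  It says that x_n / G t_n does not change with n ([x_seq_G]).  Since t_n
    tends to 1 ([t_seq_lim]), where G is continuous with value 1, x_n tends to
    this constant, and so does y_n = t_n x_n.

    Landen's transformation is proved through a differential equation.  The
    hypergeometric equation makes G a solution of the Legendre equation
    ((1 - t^2) G')' = G / 4 ([is_derive_flux]), and from this both sides of the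
    identity solve, as functions of s,

      (p f')' = q f,  p = s (1 - s) / (1 + s),  q = (1 - s) / (1 + s)^3.

    For two solutions A, B the quantity p (A' B - A B') is constant; it vanishes
    at s = 1, where p does ([wronskian_zero]).  Hence A / B is constant, and its
    value at s = 1 is 1.

    As for the choice of N: from the first step on, t_n <= 1, and t_n > 0 holds
    eventually because t_n tends to 1. *)

(** * The series F(1/4,1/4,1;z) and its differential equation *)

Definition hyp_coef (n : nat) : R :=
  shifted_fact (1 / 4) n * shifted_fact (1 / 4) n
  / (shifted_fact 1 n * shifted_fact 1 n).

Lemma shifted_fact_pos (a : R) (n : nat) : 0 < a -> 0 < shifted_fact a n.
Proof.
  intros Ha; induction n as [|n IH]; simpl; [lra|].
  apply Rmult_lt_0_compat; [exact IH|].
  pose proof (pos_INR n); lra.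
Qed.

Lemma hyp_coef_0 : hyp_coef 0 = 1.
Proof. unfold hyp_coef; simpl; field. Qed.

(** The hypergeometric equation in coefficient form. *)
Lemma hyp_coef_S (n : nat) :
  INR (S n) ^ 2 * hyp_coef (S n) = (INR n + 1 / 4) ^ 2 * hyp_coef n.
Proof.
  rewrite S_INR; unfold hyp_coef; simpl shifted_fact.
  pose proof (pos_INR n); pose proof (shifted_fact_pos 1 n Rlt_0_1).
  field; split; lra.
Qed.

(** Bounded coefficients give a radius of convergence at least 1, and positive
    ones keep the sum away from 0, so that it can be divided by. *)
Lemma hyp_coef_bounds (n : nat) : 0 < hyp_coef n <= 1.
Proof.
  induction n as [|n IH]; [rewrite hyp_coef_0; lra|].
  pose proof (hyp_coef_S n) as E.
  pose proof (pos_INR n) as Hn; rewrite S_INR in E.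
  split.
  - apply Rmult_lt_reg_l with ((INR n + 1) ^ 2); [nra|].
    rewrite E, Rmult_0_r; apply Rmult_lt_0_compat; nra.
  - apply Rmult_le_reg_l with ((INR n + 1) ^ 2); [nra|].
    rewrite E; apply Rmult_le_compat; nra.
Qed.

Definition hyp (z : R) : R := PSeries hyp_coef z.

(** The Euler operator z d/dz applied to F: in terms of it the hypergeometric
    equation needs only first derivatives. *)
Definition euler_hyp (z : R) : R := z * PSeries (PS_derive hyp_coef) z.

Lemma hyp_coef_radius (z : R) :
  Rabs z < 1 -> Rbar_lt (Rabs z) (CV_radius hyp_coef).
Proof.
  intros Hz.
  apply Rbar_lt_le_trans with (Finite 1); [exact Hz|].
  apply (proj1 (CV_radius_bounded hyp_coef)).
  exists 1; intros n.
  rewrite pow1, Rmult_1_r.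
  pose proof (hyp_coef_bounds n); rewrite Rabs_pos_eq; lra.
Qed.

Lemma is_derive_hyp (z : R) :
  Rabs z < 1 -> is_derive hyp z (PSeries (PS_derive hyp_coef) z).
Proof. intros Hz; apply is_derive_PSeries, hyp_coef_radius, Hz. Qed.

Lemma ex_derive_euler_hyp (z : R) : Rabs z < 1 -> ex_derive euler_hyp z.
Proof.
  intros Hz; unfold euler_hyp.
  apply (ex_derive_mult (fun z => z)); [apply ex_derive_id|].
  eexists; apply is_derive_PSeries.
  rewrite CV_radius_derive; apply hyp_coef_radius, Hz.
Qed.

(** With E = z F', the coefficients of E and E' are n a_n and (n + 1)^2 a_(n+1).
    By the recurrence the latter equals (n^2 + n/2 + 1/16) a_n, which is the
    coefficient of z E' + E / 2 + F / 16. *)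
Lemma hypergeometric_equation (z : R) :
  Rabs z < 1 ->
  (1 - z) * Derive euler_hyp z = euler_hyp z / 2 + hyp z / 16.
Proof.
  intros Hz.
  pose (e := PS_incr_1 (PS_derive hyp_coef)).
  assert (Re : CV_radius e = CV_radius hyp_coef).
  { unfold e; rewrite CV_radius_incr_1; apply CV_radius_derive. }
  assert (Ee : forall w, euler_hyp w = PSeries e w).
  { intros w; unfold euler_hyp, e; symmetry; apply PSeries_incr_1. }
  assert (De : Derive euler_hyp z = PSeries (PS_derive e) z).
  { rewrite (Derive_ext _ _ _ Ee).
    apply is_derive_unique, is_derive_PSeries.
    rewrite Re; apply hyp_coef_radius, Hz. }
  assert (C0 : ex_pseries hyp_coef z)
    by apply CV_radius_inside, hyp_coef_radius, Hz.
  assert (C1 : ex_pseries e z).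
  { apply CV_radius_inside; rewrite Re; apply hyp_coef_radius, Hz. }
  assert (C2 : ex_pseries (PS_derive e) z).
  { apply ex_pseries_derive; rewrite Re; apply hyp_coef_radius, Hz. }
  rewrite De, Ee; unfold hyp.
  enough (S : PSeries (PS_derive e) z =
              z * PSeries (PS_derive e) z
              + (1 / 2 * PSeries e z + 1 / 16 * PSeries hyp_coef z)) by lra.
  rewrite <- (PSeries_scal (1 / 2)), <- (PSeries_scal (1 / 16)), <- PSeries_incr_1.
  rewrite <- PSeries_plus; [|apply ex_pseries_scal; [apply Rmult_comm|assumption]..].
  rewrite <- PSeries_plus; [|apply ex_pseries_incr_1, C2|
    apply ex_pseries_plus; apply ex_pseries_scal; try apply Rmult_comm; assumption].
  apply PSeries_ext; intros n.
  unfold PS_plus, PS_scal, PS_derive at 1; unfold e at 1.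
  unfold plus, scal; simpl; unfold mult; simpl.
  change (PS_derive hyp_coef n) with (INR (S n) * hyp_coef (S n)).
  pose proof (hyp_coef_S n) as E.
  destruct n as [|n].
  - unfold e; simpl in E |- *; unfold zero; simpl; lra.
  - unfold e, PS_derive; simpl PS_incr_1.
    change (match n with O => 1 | S _ => INR n + 1 end) with (INR (S n)) in *.
    rewrite !S_INR in *. lra.
Qed.

Lemma hyp_ge_1 (z : R) : 0 <= z < 1 -> 1 <= hyp z.
Proof.
  intros Hz.
  assert (C : ex_series (fun n => hyp_coef n * z ^ n)).
  { apply ex_pseries_R, CV_radius_inside, hyp_coef_radius.
    rewrite Rabs_pos_eq; lra. }
  unfold hyp, PSeries; rewrite Series_incr_1 by exact C.
  rewrite hyp_coef_0; simpl pow at 1.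
  enough (0 <= Series (fun n => hyp_coef (S n) * z ^ S n)) by lra.
  rewrite <- (PSeries_const_0 1) at 1; unfold PSeries.
  apply Series_le.
  - intros n; rewrite Rmult_0_l; split; [lra|].
    apply Rmult_le_pos; [apply Rlt_le, hyp_coef_bounds|apply pow_le; lra].
  - apply (ex_series_incr_1 (fun n => hyp_coef n * z ^ n)), C.
Qed.

(** * The Legendre function F(1/4,1/4,1;1-t^2) *)

(** For 0 < t <= 1 this is the Legendre function of degree -1/2, that is,
    F(1/2,1/2,1; (1-t)/2). *)
Definition G (t : R) : R := hyp (1 - t ^ 2).

Definition dG (t : R) : R := - 2 * t * PSeries (PS_derive hyp_coef) (1 - t ^ 2).

(** The flux (1 - t^2) G' of the Legendre equation in self-adjoint form, written
    without the derivative of G so that it can be differentiated. *)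
Definition flux (t : R) : R := - 2 * t * euler_hyp (1 - t ^ 2).

Lemma flux_dG (t : R) : flux t = (1 - t ^ 2) * dG t.
Proof. unfold flux, dG, euler_hyp; ring. Qed.

Lemma Rabs_argument (t : R) : 0 < t <= 1 -> Rabs (1 - t ^ 2) < 1.
Proof. intros Ht; rewrite Rabs_pos_eq; nra. Qed.

Lemma is_derive_G (t : R) : 0 < t <= 1 -> is_derive G t (dG t).
Proof.
  intros Ht; unfold G.
  pose proof (is_derive_hyp _ (Rabs_argument t Ht)) as H.
  assert (K : is_derive (fun t => 1 - t ^ 2) t (- 2 * t))
    by (auto_derive; [exact I|ring]).
  evar_last.
  - exact (is_derive_comp hyp (fun t => 1 - t ^ 2) t _ _ H K).
  - unfold dG, scal; simpl; unfold mult; simpl; ring.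
Qed.

(** The Legendre equation of degree -1/2.  With z = 1 - t^2 and E = z F', the
    flux is -2 t E(z), whose derivative -2 E + 4 (1 - z) E' is F / 4 by the
    hypergeometric equation. *)
Lemma is_derive_flux (t : R) : 0 < t <= 1 -> is_derive flux t (G t / 4).
Proof.
  intros Ht; unfold flux.
  pose proof (Rabs_argument t Ht) as Hz.
  pose proof (hypergeometric_equation _ Hz) as E.
  replace (1 - (1 - t ^ 2)) with (t ^ 2) in E by ring.
  assert (K : is_derive (fun t => 1 - t ^ 2) t (- 2 * t))
    by (auto_derive; [exact I|ring]).
  pose proof (is_derive_comp euler_hyp (fun t => 1 - t ^ 2) t _ _
                (Derive_correct _ _ (ex_derive_euler_hyp _ Hz)) K) as C.
  assert (L : is_derive (fun t => - 2 * t) t (- 2)) by (auto_derive; [exact I|ring]).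
  evar_last.
  - exact (is_derive_mult (fun t => - 2 * t) _ t _ _ L C Rmult_comm).
  - unfold plus, scal, mult; simpl; unfold mult; simpl; unfold G.
    simpl pow in *.
    transitivity (- 2 * euler_hyp (1 - t * (t * 1))
                  + 4 * (t * (t * 1) * Derive euler_hyp (1 - t * (t * 1)))); [ring|].
    rewrite E; field.
Qed.

Lemma G_pos (t : R) : 0 < t <= 1 -> 0 < G t.
Proof.
  intros Ht; apply Rlt_le_trans with 1; [lra|].
  apply hyp_ge_1; nra.
Qed.

Lemma G_1 : G 1 = 1.
Proof.
  unfold G, hyp; replace (1 - 1 ^ 2) with 0 by ring.
  rewrite PSeries_0; apply hyp_coef_0.
Qed.

(** * Landen's transformation *)

(** If s = sqrt ((1 + t) / 2) for the ratio t = y / x of a pair, then t is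
    [sigma s] and the ratio of the next pair is [tau s].  For Landen's
    transformation s is kept as the variable, so that both ratios are rational
    functions of it. *)
Definition tau (s : R) : R := 8 * s / (1 + s) ^ 2 - 1.

Definition sigma (s : R) : R := 2 * s ^ 2 - 1.

Lemma is_derive_tau (s : R) :
  0 < s -> is_derive tau s (8 * (1 - s) / (1 + s) ^ 3).
Proof. intros Hs; unfold tau; auto_derive; [nra|field; lra]. Qed.

Lemma is_derive_sigma (s : R) : is_derive sigma s (4 * s).
Proof. unfold sigma; auto_derive; [exact I|ring]. Qed.

(** The upper bound 1 is the inequality 4 s <= (1 + s)^2 between means. *)
Lemma tau_range (s : R) : 0 < s -> -1 < tau s <= 1.
Proof.
  intros Hs; unfold tau; split.
  - assert (0 < 8 * s / (1 + s) ^ 2) by (apply Rdiv_lt_0_compat; nra). lra.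
  - enough (8 * s / (1 + s) ^ 2 <= 2) by lra.
    pose proof (pow2_ge_0 (1 - s)).
    apply Rle_div_l; nra.
Qed.

Lemma sigma_range (s : R) : 1 / 2 < s ^ 2 -> 0 < s <= 1 -> 0 < sigma s <= 1.
Proof. unfold sigma; nra. Qed.

Lemma tau_range_unit (s : R) : 1 / 2 < s ^ 2 -> 0 < s <= 1 -> 0 < tau s <= 1.
Proof.
  intros Hs2 Hs; split; [|apply tau_range; lra].
  unfold tau; enough (1 < 8 * s / (1 + s) ^ 2) by lra.
  apply Rlt_div_r; nra.
Qed.

Lemma is_derive_zero_eq (f : R -> R) (a b : R) :
  a <= b ->
  (forall u, a < u < b -> is_derive f u 0) ->
  (forall u, a <= u <= b -> ex_derive f u) ->
  f a = f b.
Proof.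
  intros Hab Hd Hc.
  destruct (MVT_gen f a b (fun _ => 0)) as [c [_ E]].
  - rewrite Rmin_left, Rmax_right by exact Hab; exact Hd.
  - rewrite Rmin_left, Rmax_right by exact Hab; intros u Hu.
    apply continuity_pt_filterlim.
    exact (ex_derive_continuous (K := R_AbsRing) (V := R_NormedModule) f u (Hc u Hu)).
  - lra.
Qed.

(** The quantity p (A' B - A B') with p = s (1 - s) / (1 + s),
    A s = G (tau s) and B s = (1 + s) / 2 * G (sigma s).  The singular factor
    1 - s has been absorbed into the fluxes: p A' = flux (tau s) / 2 and
    p B' = (s (1 - s) G (sigma s) + flux (sigma s)) / (2 (1 + s)). *)
Definition wronskian (s : R) : R :=
  (1 + s) / 4 * flux (tau s) * G (sigma s)
  - G (tau s) * (s * (1 - s) * G (sigma s) + flux (sigma s)) / (2 * (1 + s)).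

(** Both functions solve (p f')' = q f with the same p and q, so the
    derivative is q (A B - A B) = 0. *)
Lemma is_derive_wronskian (s : R) :
  1 / 2 < s ^ 2 -> 0 < s <= 1 -> is_derive wronskian s 0.
Proof.
  intros Hs2 Hs.
  pose proof (sigma_range s Hs2 Hs) as Hsig.
  pose proof (tau_range_unit s Hs2 Hs) as Htau.
  pose proof (is_derive_G _ Hsig) as G1.
  pose proof (is_derive_G _ Htau) as G2.
  pose proof (is_derive_flux _ Hsig) as F1.
  pose proof (is_derive_flux _ Htau) as F2.
  pose proof (is_derive_tau s ltac:(lra)) as Dt.
  pose proof (is_derive_sigma s) as Ds.
  unfold wronskian; auto_derive.
  - repeat split; try (eexists; eassumption); lra.
  - rewrite (is_derive_unique (fun x : R => G x) _ _ G1),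
      (is_derive_unique (fun x : R => G x) _ _ G2),
      (is_derive_unique (fun x : R => flux x) _ _ F1),
      (is_derive_unique (fun x : R => flux x) _ _ F2),
      (is_derive_unique (fun x : R => tau x) _ _ Dt),
      (is_derive_unique (fun x : R => sigma x) _ _ Ds).
    rewrite !flux_dG.
    generalize (G (tau s)) (G (sigma s)) (dG (tau s)) (dG (sigma s)).
    intros g1 g2 h1 h2; unfold tau, sigma; field; lra.
Qed.

Lemma wronskian_zero (s : R) :
  1 / 2 < s ^ 2 -> 0 < s <= 1 -> wronskian s = 0.
Proof.
  intros Hs2 Hs.
  assert (D : forall u, s <= u <= 1 -> is_derive wronskian u 0).
  { intros u Hu; apply is_derive_wronskian; nra. }
  rewrite (is_derive_zero_eq wronskian s 1).
  - unfold wronskian; rewrite !flux_dG; unfold tau, sigma.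
    replace (8 * 1 / (1 + 1) ^ 2 - 1) with 1 by field.
    replace (2 * 1 ^ 2 - 1) with 1 by ring.
    field.
  - lra.
  - intros u Hu; apply D; lra.
  - intros u Hu; eexists; apply D, Hu.
Qed.

(** Landen's transformation of the complete elliptic integral, for the Legendre
    function.  The quotient of the two sides has derivative
    wronskian / (p B^2) = 0 on s < 1.  At s = 1 this expression is 0 / 0, so the
    quotient is only known to be differentiable there, which is enough for the
    mean value theorem. *)
Lemma landen (s : R) :
  1 / 2 < s ^ 2 -> 0 < s <= 1 -> G (tau s) = (1 + s) / 2 * G (sigma s).
Proof.
  intros Hs2 Hs.
  pose (quot u := 2 * G (tau u) / ((1 + u) * G (sigma u))).
  assert (D : forall u, s <= u <= 1 -> is_derive quot u
    (2 * (dG (tau u) * (8 * (1 - u) / (1 + u) ^ 3) * ((1 + u) * G (sigma u))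
          - G (tau u) * (G (sigma u) + (1 + u) * (dG (sigma u) * (4 * u))))
     / ((1 + u) * G (sigma u)) ^ 2)).
  { intros u Hu.
    assert (Hu2 : 1 / 2 < u ^ 2) by nra.
    assert (Hu1 : 0 < u <= 1) by lra.
    pose proof (sigma_range u Hu2 Hu1) as Hsig.
    pose proof (tau_range_unit u Hu2 Hu1) as Htau.
    pose proof (is_derive_G _ Hsig) as G1.
    pose proof (is_derive_G _ Htau) as G2.
    pose proof (is_derive_tau u ltac:(lra)) as Dt.
    pose proof (is_derive_sigma u) as Ds.
    pose proof (G_pos _ Hsig) as P.
    unfold quot; auto_derive.
    - repeat split; try (eexists; eassumption); nra.
    - rewrite (is_derive_unique (fun x : R => G x) _ _ G1),
        (is_derive_unique (fun x : R => G x) _ _ G2),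
        (is_derive_unique (fun x : R => tau x) _ _ Dt),
        (is_derive_unique (fun x : R => sigma x) _ _ Ds).
      field; lra. }
  assert (E : quot s = quot 1).
  { apply is_derive_zero_eq; [lra| |intros u Hu; eexists; apply D, Hu].
    intros u Hu; evar_last; [apply D; lra|].
    assert (Hu2 : 1 / 2 < u ^ 2) by nra.
    assert (Hu1 : 0 < u <= 1) by lra.
    pose proof (G_pos _ (sigma_range u Hu2 Hu1)) as P.
    pose proof (wronskian_zero u Hu2 Hu1) as W.
    (* In the notation of [wronskian] the bracketed difference is
       2 (A' B - A B') = 2 * wronskian u / p. *)
    replace (dG (tau u) * (8 * (1 - u) / (1 + u) ^ 3) * ((1 + u) * G (sigma u))
          - G (tau u) * (G (sigma u) + (1 + u) * (dG (sigma u) * (4 * u))))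
      with (2 * (1 + u) / (u * (1 - u)) * wronskian u).
    - rewrite W; field; nra.
    - unfold wronskian; rewrite !flux_dG.
      generalize dependent (G (sigma u)).
      generalize (G (tau u)) (dG (tau u)) (dG (sigma u)).
      intros; unfold tau, sigma; field; nra. }
  unfold quot in E.
  replace (tau 1) with 1 in E by (unfold tau; field).
  replace (sigma 1) with 1 in E by (unfold sigma; ring).
  rewrite G_1 in E.
  pose proof (G_pos _ (sigma_range s Hs2 Hs)) as P.
  replace (2 * 1 / ((1 + 1) * 1)) with 1 in E by field.
  replace (G (tau s)) with
    (2 * G (tau s) / ((1 + s) * G (sigma s)) * ((1 + s) * G (sigma s) / 2))
    by (field; lra).
  rewrite E; field.
Qed.

(** * The iteration on the ratio y / x *)

Definition ratio_root (t : R) : R := sqrt ((1 + t) / 2).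

Lemma sigma_ratio_root (t : R) : -1 < t -> sigma (ratio_root t) = t.
Proof.
  intros Ht; unfold sigma, ratio_root.
  rewrite pow2_sqrt by lra; field.
Qed.

Lemma ratio_root_pos (t : R) : -1 < t -> 0 < ratio_root t.
Proof. intros Ht; apply sqrt_lt_R0; lra. Qed.

Lemma ratio_root_le_1 (t : R) : t <= 1 -> ratio_root t <= 1.
Proof.
  intros Ht; unfold ratio_root.
  pose proof (sqrt_le_1_alt ((1 + t) / 2) 1 ltac:(lra)) as H.
  rewrite sqrt_1 in H; exact H.
Qed.

(** Everything is homogeneous of degree 1 in (x, y), and
    mu0 x y = x * sqrt ((1 + y / x) / 2). *)
Lemma mu_ratio (x y : R) : 0 < x -> 0 < x + y ->
  mu1 x y = x * (1 + ratio_root (y / x)) / 2 /\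
  mu2 x y = mu1 x y * tau (ratio_root (y / x)).
Proof.
  intros hx hxy.
  assert (Ht : -1 < y / x) by (apply Rlt_div_r; lra).
  pose proof (ratio_root_pos _ Ht) as Hs.
  assert (E : mu0 x y = x * ratio_root (y / x)).
  { unfold mu0, ratio_root.
    replace (x * ((x + y) / 2)) with (x ^ 2 * ((1 + y / x) / 2)) by (field; lra).
    rewrite sqrt_mult by nra.
    rewrite sqrt_pow2 by lra; reflexivity. }
  pose proof (Rmult_lt_0_compat _ _ hx Hs) as Hp.
  unfold mu1, mu2, nu, m_H, m_A, tau; rewrite E; split; field; lra.
Qed.

Lemma mu_iter_domain (x y : R) (n : nat) : 0 < x -> 0 < x + y ->
  0 < x_seq x y n /\ 0 < x_seq x y n + y_seq x y n.
Proof.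
  intros hx hxy; induction n as [|n [IHx IHxy]]; [split; assumption|].
  change (x_seq x y (S n)) with (mu1 (x_seq x y n) (y_seq x y n)).
  change (y_seq x y (S n)) with (mu2 (x_seq x y n) (y_seq x y n)).
  destruct (mu_ratio _ _ IHx IHxy) as [E1 E2].
  assert (Ht : -1 < y_seq x y n / x_seq x y n) by (apply Rlt_div_r; lra).
  pose proof (ratio_root_pos _ Ht) as Hs.
  pose proof (tau_range _ Hs) as Hr.
  rewrite E2.
  assert (0 < mu1 (x_seq x y n) (y_seq x y n)) by (rewrite E1; nra).
  split; [assumption|nra].
Qed.

Definition t_seq (x y : R) (n : nat) : R := y_seq x y n / x_seq x y n.

Lemma t_seq_gt (x y : R) (n : nat) : 0 < x -> 0 < x + y -> -1 < t_seq x y n.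
Proof.
  intros hx hxy; destruct (mu_iter_domain x y n hx hxy).
  unfold t_seq; apply Rlt_div_r; lra.
Qed.

Lemma t_seq_S (x y : R) (n : nat) : 0 < x -> 0 < x + y ->
  t_seq x y (S n) = tau (ratio_root (t_seq x y n)).
Proof.
  intros hx hxy.
  destruct (mu_iter_domain x y n hx hxy) as [P1 P2].
  destruct (mu_iter_domain x y (S n) hx hxy) as [Q _].
  unfold t_seq at 1.
  change (y_seq x y (S n)) with (mu2 (x_seq x y n) (y_seq x y n)).
  change (x_seq x y (S n)) with (mu1 (x_seq x y n) (y_seq x y n)) in *.
  rewrite (proj2 (mu_ratio _ _ P1 P2)).
  unfold t_seq; field; lra.
Qed.

(** From the first step on the ratio is at most 1, even if y > x initially. *)
Lemma t_seq_S_le_1 (x y : R) (n : nat) : 0 < x -> 0 < x + y ->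
  t_seq x y (S n) <= 1.
Proof.
  intros hx hxy; rewrite t_seq_S by assumption.
  apply tau_range, ratio_root_pos, t_seq_gt; assumption.
Qed.

(** Quadratic convergence of the ratio to 1: with s = ratio_root t the two sides
    are 2 (1 - s)^2 / (1 + s)^2 and 2 (1 - s)^2 (1 + s)^2. *)
Lemma tau_defect (t : R) : -1 < t <= 1 ->
  1 - tau (ratio_root t) <= (1 - t) ^ 2 / 2.
Proof.
  intros Ht.
  pose proof (ratio_root_pos t (proj1 Ht)) as Hs.
  pose proof (ratio_root_le_1 t (proj2 Ht)) as Hs1.
  rewrite <- (sigma_ratio_root t) at 2 by lra.
  generalize dependent (ratio_root t); intros s Hs Hs1.
  unfold tau, sigma.
  replace (1 - (8 * s / (1 + s) ^ 2 - 1)) with (2 * (1 - s) ^ 2 / (1 + s) ^ 2)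
    by (field; lra).
  replace ((1 - (2 * s ^ 2 - 1)) ^ 2 / 2) with (2 * (1 - s) ^ 2 * (1 + s) ^ 2)
    by field.
  pose proof (pow2_ge_0 (1 - s)) as Hsq.
  apply Rle_div_l; [nra|].
  rewrite Rmult_assoc.
  assert (1 <= (1 + s) ^ 2) by nra.
  assert (1 <= (1 + s) ^ 2 * (1 + s) ^ 2) by nra.
  nra.
Qed.

(** A geometric bound with ratio (1 - t_1) / 2 < 1 is all that the limit needs;
    it follows from the quadratic estimate because the defect 1 - t_n never
    exceeds 1 - t_1. *)
Lemma t_seq_defect (x y : R) (n : nat) : 0 < x -> 0 < x + y ->
  1 - t_seq x y (S n)
  <= (1 - t_seq x y 1) * ((1 - t_seq x y 1) / 2) ^ n.
Proof.
  intros hx hxy.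
  pose proof (t_seq_gt x y 1 hx hxy) as H1.
  pose proof (t_seq_S_le_1 x y 0 hx hxy) as H1'.
  induction n as [|n IH]; [simpl; lra|].
  pose proof (t_seq_gt x y (S n) hx hxy) as Hn.
  pose proof (t_seq_S_le_1 x y n hx hxy) as Hn'.
  rewrite t_seq_S by assumption.
  pose proof (tau_defect _ (conj Hn Hn')) as D.
  set (d := 1 - t_seq x y 1) in *.
  assert (Hp : 0 <= (d / 2) ^ n <= 1).
  { split; [apply pow_le|rewrite <- (pow1 n); apply pow_incr]; unfold d; lra. }
  simpl; assert (0 <= d) by (unfold d; lra).
  assert (1 - t_seq x y (S n) <= d) by nra.
  nra.
Qed.

Lemma t_seq_lim (x y : R) : 0 < x -> 0 < x + y -> is_lim_seq (t_seq x y) 1.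
Proof.
  intros hx hxy.
  apply is_lim_seq_incr_1.
  pose proof (t_seq_gt x y 1 hx hxy) as H1.
  pose proof (t_seq_S_le_1 x y 0 hx hxy) as H1'.
  set (d := 1 - t_seq x y 1).
  apply (is_lim_seq_le_le (fun n => 1 - d * (d / 2) ^ n) _ (fun _ => 1)).
  - intros n; split; [|apply t_seq_S_le_1; assumption].
    pose proof (t_seq_defect x y n hx hxy); unfold d; lra.
  - replace (Finite 1) with (Finite (1 - d * 0)) by (f_equal; ring).
    apply is_lim_seq_minus'; [apply is_lim_seq_const|].
    apply (is_lim_seq_scal_l _ d (Finite 0)), is_lim_seq_geom.
    rewrite Rabs_pos_eq; unfold d; lra.
  - apply is_lim_seq_const.
Qed.

(** * The invariant and the limit *)

(** Landen's transformation read along the sequence: x and G (y / x) are both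
    multiplied by (1 + s) / 2. *)
Lemma x_seq_G (x y : R) (n : nat) : 0 < x -> 0 < x + y ->
  0 < t_seq x y n <= 1 ->
  x_seq x y (S n) / G (t_seq x y (S n)) = x_seq x y n / G (t_seq x y n).
Proof.
  intros hx hxy Ht.
  destruct (mu_iter_domain x y n hx hxy) as [P1 P2].
  rewrite t_seq_S by assumption.
  change (x_seq x y (S n)) with (mu1 (x_seq x y n) (y_seq x y n)).
  rewrite (proj1 (mu_ratio _ _ P1 P2)); fold (t_seq x y n).
  pose proof (ratio_root_pos (t_seq x y n) ltac:(lra)) as Hs.
  pose proof (ratio_root_le_1 _ (proj2 Ht)) as Hs1.
  pose proof (sigma_ratio_root (t_seq x y n) ltac:(lra)) as E.
  pose proof (G_pos _ Ht) as HG.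
  rewrite landen; [|unfold sigma in E; lra|lra].
  rewrite E; field; lra.
Qed.

Theorem theorem6p13 (x y : R) (hx : 0 < x) (hxy : 0 < x + y) :
  exists N : nat,
    (forall n : nat, (N <= n)%nat -> 0 < y_seq x y n <= x_seq x y n) /\
    is_lim_seq (x_seq x y)
      (Finite (x_seq x y N
               / hypergeom (1 / 4) (1 / 4) 1
                   (1 - (y_seq x y N) ^ 2 / (x_seq x y N) ^ 2))) /\
    is_lim_seq (y_seq x y)
      (Finite (x_seq x y N
               / hypergeom (1 / 4) (1 / 4) 1
                   (1 - (y_seq x y N) ^ 2 / (x_seq x y N) ^ 2))).
Proof.
  pose proof (t_seq_lim x y hx hxy) as L.
  (* |t_n - 1| < 1 gives t_n > 0; the index after M is taken because t_n <= 1 is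
     only guaranteed for n >= 1. *)
  destruct (proj2 (is_lim_seq_spec _ _) L (mkposreal 1 Rlt_0_1)) as [M HM].
  simpl in HM.
  assert (T : forall n, (S M <= n)%nat -> 0 < t_seq x y n <= 1).
  { intros [|n] Hn; [lia|].
    split; [|apply t_seq_S_le_1; assumption].
    specialize (HM (S n) ltac:(lia)); apply Rabs_def2 in HM; lra. }
  assert (P : forall n, 0 < x_seq x y n)
    by (intros n; apply mu_iter_domain; assumption).
  assert (Y : forall n, t_seq x y n * x_seq x y n = y_seq x y n).
  { intros n; pose proof (P n); unfold t_seq; field; lra. }
  exists (S M).
  pose proof (P (S M)) as PM.
  replace (1 - y_seq x y (S M) ^ 2 / x_seq x y (S M) ^ 2)
    with (1 - t_seq x y (S M) ^ 2) by (unfold t_seq; field; lra).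
  change (hypergeom (1 / 4) (1 / 4) 1 (1 - t_seq x y (S M) ^ 2))
    with (G (t_seq x y (S M))).
  set (l := x_seq x y (S M) / G (t_seq x y (S M))).
  assert (I : forall k, x_seq x y (k + S M) = l * G (t_seq x y (k + S M))).
  { intros k.
    assert (E : x_seq x y (k + S M) / G (t_seq x y (k + S M)) = l).
    { induction k as [|k IH]; [reflexivity|].
      rewrite <- IH; apply x_seq_G; try assumption; apply T; lia. }
    pose proof (G_pos _ (T (k + S M)%nat ltac:(lia))).
    rewrite <- E; field; lra. }
  assert (Lx : is_lim_seq (x_seq x y) l).
  { apply (is_lim_seq_incr_n _ (S M)).
    apply (is_lim_seq_ext _ _ _ (fun k => eq_sym (I k))).
    replace (Finite l) with (Finite (l * G 1)) by (rewrite G_1; f_equal; ring).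
    apply (is_lim_seq_scal_l _ l (Finite (G 1))).
    apply is_lim_seq_continuous; [|apply is_lim_seq_incr_n; exact L].
    apply continuity_pt_filterlim.
    apply (ex_derive_continuous (K := R_AbsRing) (V := R_NormedModule) G 1).
    eexists; apply is_derive_G; lra. }
  split; [|split; [exact Lx|]].
  - intros n Hn; pose proof (T n Hn); pose proof (P n); rewrite <- (Y n); nra.
  - apply (is_lim_seq_ext _ _ _ Y).
    replace (Finite l) with (Finite (1 * l)) by (f_equal; ring).
    apply is_lim_seq_mult'; assumption.
Qed.
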